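(* Let $G=(V,E)$ be a graph without isolated vertices and suppose that $G$ is fully reconstructible in $\mathbb{C}^d$. Then $G$ is $M$-connected in $\mathbb{R}^d$.
   Context: Graphs are finite and simple. For $p:V\to\mathbb{C}^d$, the complex squared length of edge $uv$ is $m_{uv}(p)=\sum_{k=1}^d(p(u)_k-p(v)_k)^2$. A framework is generic if its coordinates are algebraically independent over $\mathbb{Q}$. $(G,p),(H,q)$ are length-equivalent under a bijection $\psi:E(G)\to E(H)$ if $m_e(p)=m_{\psi(e)}(q)$ for all $e\in E(G)$. A generic $(G,p)$ in $\mathbb{C}^d$ ($G$ without isolated vertices) is fully reconstructible if for every graph $H$ without isolated vertices and every generic $(H,q)$ in $\mathbb{C}^d$ length-equivalent to $(G,p)$ under some $\psi$, there is an isomorphism $\varphi:V(G)\to V(H)$ with $\psi(uv)=\varphi(u)\varphi(v)$ for all edges $uv$; $G$ is fully reconstructible in $\mathbb{C}^d$ if every generic realization in $\mathbb{C}^d$ is. The rigidity matrix $R(G,p)$ is the $|E|\times d|V|$ matrix whose row for $uv$ has $p(u)-p(v)$ in the columns of $u$, $p(v)-p(u)$ in the columns of $v$, zeros elsewhere; the $d$-dimensional rigidity matroid $\mathcal{R}_d(G)$ on $E$ is given by row independence of $R(G,p)$ for generic $p\in\mathbb{R}^{d|V|}$. $G$ is $M$-connected in $\mathbb{R}^d$ if $\mathcal{R}_d(G)$ is a connected matroid (any two distinct elements lie in a common circuit). *)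

(* Defs.v *)
From mathcomp Require Import all_boot all_order all_algebra.
From mathcomp Require Import reals.
From mathcomp Require Import complex.
From mathcomp Require Import mpoly.
Set Implicit Arguments. Unset Strict Implicit. Unset Printing Implicit Defensive.
Import GRing.Theory.
Local Open Scope ring_scope.

Definition alg_indep (F : fieldType) (I : finType) (x : I -> F) : Prop :=
  forall P : {mpoly rat[#|I|]},
    (map_mpoly (ratr : rat -> F) P).@[fun i => x (enum_val i)] = 0 -> P = 0.

Definition simple_graph (V : finType) (E : {set {set V}}) : Prop :=
  forall e, e \in E -> #|e| = 2%N.

Definition no_isolated (V : finType) (E : {set {set V}}) : Prop :=
  forall v : V, exists2 e, e \in E & v \in e.

Definition generic (F : fieldType) (d : nat) (V : finType) (p : V -> 'I_d -> F) : Prop :=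
  alg_indep (fun vk : V * 'I_d => p vk.1 vk.2).

Definition sqlen (F : fieldType) (d : nat) (V : finType) (p : V -> 'I_d -> F) (u v : V) : F :=
  \sum_(k < d) (p u k - p v k) ^+ 2.

Definition length_equiv (F : fieldType) (d : nat) (V W : finType)
    (EG : {set {set V}}) (p : V -> 'I_d -> F)
    (EH : {set {set W}}) (q : W -> 'I_d -> F) (psi : {set V} -> {set W}) : Prop :=
  [/\ {in EG, forall e, psi e \in EH},
      {in EG &, injective psi},
      EH \subset psi @: EG &
      forall u v, [set u; v] \in EG ->
        forall x y, psi [set u; v] = [set x; y] -> sqlen p u v = sqlen q x y].

Definition fully_reconstructible_fw (R : realType) (d : nat) (V : finType)
    (EG : {set {set V}}) (p : V -> 'I_d -> R[i]) : Prop :=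
  forall (W : finType) (EH : {set {set W}}) (q : W -> 'I_d -> R[i])
         (psi : {set V} -> {set W}),
    simple_graph EH -> no_isolated EH -> generic q ->
    length_equiv EG p EH q psi ->
    exists phi : V -> W, bijective phi /\
      forall u v, [set u; v] \in EG -> psi [set u; v] = [set phi u; phi v].

Definition fully_reconstructible (R : realType) (d : nat) (V : finType)
    (EG : {set {set V}}) : Prop :=
  forall p : V -> 'I_d -> R[i], generic p -> fully_reconstructible_fw EG p.

(* entry of the row of the rigidity matrix R(G,p) for edge e, in column (w,k):
   p(w)_k - p(x)_k if e = {w,x}, and 0 if w is not in e *)
Definition rig_entry (R : realType) (d : nat) (V : finType) (p : V -> 'I_d -> R)
    (e : {set V}) (w : V) (k : 'I_d) : R :=
  if w \in e then \sum_(x in e :\ w) (p w k - p x k) else 0.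

Definition rows_indep (R : realType) (d : nat) (V : finType) (p : V -> 'I_d -> R)
    (F : {set {set V}}) : Prop :=
  forall lam : {set V} -> R,
    (forall (w : V) (k : 'I_d), \sum_(e in F) lam e * rig_entry p e w k = 0) ->
    forall e, e \in F -> lam e = 0.

Definition rmat_indep (R : realType) (d : nat) (V : finType) (F : {set {set V}}) : Prop :=
  forall p : V -> 'I_d -> R, generic p -> rows_indep p F.

Definition rmat_circuit (R : realType) (d : nat) (V : finType)
    (E C : {set {set V}}) : Prop :=
  [/\ C \subset E, ~ rmat_indep R d C &
      forall C' : {set {set V}}, C' \proper C -> rmat_indep R d C'].

Definition M_connected (R : realType) (d : nat) (V : finType) (E : {set {set V}}) : Prop :=
  forall e f, e \in E -> f \in E -> e != f ->
    exists C, [/\ rmat_circuit R d E C, e \in C & f \in C].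

(* Main.v *)
From mathcomp Require Import boolp classical_sets.
Require Import Defs.
From mathcomp Require Import all_boot all_order all_algebra.
From mathcomp Require Import reals complex mpoly ring lra.
Set Implicit Arguments. Unset Strict Implicit. Unset Printing Implicit Defensive.
Import Order.TTheory GRing.Theory Num.Theory.
Local Open Scope ring_scope.

(** Suppose that no circuit contains the edges [e] and [f]. Then [E] is a disjoint union
    of [S] (containing [e]) and its complement (containing [f]) such that the rigidity
    matroid is the direct sum of its restrictions. Let [H] be obtained from [G] by splitting
    the vertices common to both sides or, if there are none, by identifying a vertex of one
    side with a vertex of the other. The edge lengths of [H] are those of pairs [(y1, y2)]
    of independent realizations of the two sides, and the edge lengths of [G] are those of
    the pairs [(p, p)].

    The two sets of edge lengths satisfy the same rational polynomial relations. To see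
    this, let [P] vanish on all lengths of [G] and let [F(x, t)] be the value of [P] at the
    lengths of the pair [(x, x + t z)]. By the chain rule, [dF/dt] and [dF/dx] are
    combinations of rigidity rows of the two sides. As the rows at [t = 0] have the same
    rank as generically (this is the direct sum property), [dF/dt] is a combination of the
    [dF/dx_j] whose coefficients have no pole at [t = 0]; since [F(x, 0) = 0], this forces
    [F = 0].

    A tuple that has the same algebraic relations as the lengths of a generic realization
    of [H] is itself the tuple of lengths of a generic complex realization of [H]: adjoin
    the coordinates one by one, choosing a root of the corresponding minimal relation or a
    fresh transcendental. So generic lengths of [G] are also generic lengths of [H], which
    has a different number of vertices. *)

(** * Algebraic relations over countable domains *)

(** Cantor's nested intervals: stage [n] keeps an outer third whose closure misses [u n], and the
    supremum of the left endpoints lies in every closed interval. *)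
Lemma real_avoids_seq (R : realType) (u : nat -> R) : exists x, forall n, x != u n.
Proof.
pose step (n : nat) (ab : R * R) :=
  let m1 := (2 * ab.1 + ab.2) / 3 in let m2 := (ab.1 + 2 * ab.2) / 3 in
  if u n <= m1 then (m2, ab.2) else (ab.1, m1).
pose I := fix I n := if n is n'.+1 then step n' (I n') else (0, 1).
have stepP n ab : ab.1 < ab.2 ->
    [/\ ab.1 <= (step n ab).1, (step n ab).1 < (step n ab).2,
        (step n ab).2 <= ab.2 & (u n < (step n ab).1) || ((step n ab).2 < u n)].
  case: ab => a b /= ltab; rewrite /step /=.
  by case: (leP (u n) ((2 * a + b) / 3)) => h; split; rewrite /=; try lra; apply/orP; ((by left; lra) || (by right; lra)).
have lt_I n : (I n).1 < (I n).2.
  by elim: n => [|n IH] /=; [exact: ltr01 | case: (stepP n _ IH)].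
have mono n k : (I n).1 <= (I (n + k)%N).1 /\ (I (n + k)%N).2 <= (I n).2.
  elim: k => [|k [IH1 IH2]]; first by rewrite addn0.
  rewrite addnS /=; case: (stepP (n + k)%N _ (lt_I (n + k)%N)) => h1 _ h2 _.
  by split; [exact: le_trans h1 | exact: le_trans IH2].
have cross n m : (I n).1 <= (I m).2.
  have [h1 _] := mono n m; have [_ h2] := mono m n.
  by rewrite addnC in h2; exact: le_trans h1 (le_trans (ltW (lt_I _)) h2).
pose E := [set x | exists n, x = (I n).1]%classic.
have E0 : (E !=set0)%classic by exists (I 0).1; exists 0%N.
have ubE n : ubound E (I n).2 by move=> _ [m ->].
exists (sup E) => n.
have lo : (I n.+1).1 <= sup E.
  by apply: ub_le_sup; [exists (I 0).2; exact: ubE | exists n.+1].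
have hi : sup E <= (I n.+1).2 by exact: ge_sup (ubE _).
case: (stepP n _ (lt_I n)) => _ _ _ /orP[h|h].
  by rewrite gt_eqF // (lt_le_trans h).
by rewrite lt_eqF // (le_lt_trans hi).
Qed.

(** Countability as a bare proposition, so that it passes to polynomial rings without a [countType]
    structure on them. *)
Definition encodable (A : Type) := exists enc : A -> nat, injective enc.

Lemma encodable_inj (A B : Type) (h : A -> B) :
  injective h -> encodable B -> encodable A.
Proof. by move=> hi [enc enci]; exists (enc \o h); apply: inj_comp. Qed.

Lemma encodable_countType (A : countType) : encodable A.
Proof. by exists pickle; exact: pcan_inj pickleK. Qed.

Lemma encodable_seq (A : Type) : encodable A -> encodable (seq A).
Proof.
move=> [enc enci]; apply: encodable_inj (encodable_countType (seq nat)).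
exact: inj_map enci.
Qed.

Lemma encodable_pair (A B : Type) : encodable A -> encodable B -> encodable (A * B).
Proof.
move=> [e1 i1] [e2 i2].
apply: (@encodable_inj _ _ (fun x => (e1 x.1, e2 x.2))); last first.
  exact: encodable_countType.
by move=> [a b] [c d] [/= /i1 -> /i2 ->].
Qed.

Lemma encodable_poly (A : nzSemiRingType) : encodable A -> encodable {poly A}.
Proof. by move/encodable_seq; apply: encodable_inj; exact: poly_inj. Qed.

Lemma encodable_mpoly n (A : nzRingType) : encodable A -> encodable {mpoly A[n]}.
Proof.
move=> hA; pose h (P : {mpoly A[n]}) := [seq (m, P@_m) | m <- msupp P].
apply: (@encodable_inj _ (seq ('X_{1..n} * A)) h); last first.
  by apply/encodable_seq/encodable_pair => //; exact: encodable_countType.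
move=> P Q eqPQ; have supp S : msupp S = [seq x.1 | x <- h S].
  by rewrite /h -map_comp map_id_in.
have eqs : msupp P = msupp Q by rewrite !supp eqPQ.
apply/mpolyP => m; case mP : (m \in msupp P); last first.
  by rewrite !memN_msupp_eq0 // -?eqs mP.
have : (m, P@_m) \in h Q by rewrite -eqPQ; apply/mapP; exists m.
by case/mapP => m' _ [-> ->].
Qed.

(** The roots of the countably many nonzero polynomials over the image of [A] fit into one sequence,
    which some real number avoids. The value is real so that real generic points can be built from
    it too. *)
Lemma exists_transcendental (R : realType) (A : nzRingType) (g : {rmorphism A -> R[i]}) :
  encodable A ->
  exists x : R, forall P : {poly A},
    map_poly g P != 0 -> (map_poly g P).[real_complex R x] != 0.
Proof.
case/encodable_poly => enc enci.
pose rts (P : {poly A}) := sval (closed_field_poly_normal (map_poly g P)).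
pose code n x := exists P i, n = pickle (enc P, i) /\
  real_complex R x = nth 0 (rts P) i.
have codeU n x y : code n x -> code n y -> x = y.
  case=> P [i [-> hx]] [Q [j [/(pcan_inj pickleK) [/enci eqPQ eqij] hy]]].
  by move: hx; rewrite eqPQ eqij -hy => -[].
(* An index that codes no real root gets the value 0, which only adds one more number to avoid. *)
pose u n := if pselect (exists x, code n x) is left h then projT1 (cid h) else 0.
have [x xu] := real_avoids_seq u.
exists x => P nzP; apply: contraT => /negPn/eqP rootx.
have : real_complex R x \in rts P.
  move: rootx; rewrite /rts; case: closed_field_poly_normal => r /= def.
  rewrite def hornerZ horner_prod => /eqP; rewrite mulf_eq0 lead_coef_eq0 (negPf nzP).
  by rewrite prodf_seq_eq0 => /hasP[z zr]; rewrite hornerXsubC subr_eq0 => /eqP ->.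
move=> /(nthP 0) [i _ hi].
have cx : code (pickle (enc P, i)) x by exists P, i.
have := xu (pickle (enc P, i)); rewrite /u; case: pselect => [h|[]]; last by exists x.
by case: cid => y /= /codeU /(_ cx) ->; rewrite eqxx.
Qed.

(** * Minimal polynomial relations over a domain *)

Section MinimalRelation.
Variables (A : idomainType) (L : fieldType).

(** This is the minimal polynomial of [c] over the fraction field of the image of [f], up to
    scaling, but lifted to [A], so that a second morphism can be applied to it. *)
Definition min_relation (f : {rmorphism A -> L}) (c : L) (P : {poly A}) :=
  [/\ size (map_poly f P) = size P, f (lead_coef P) != 0, root (map_poly f P) c &
      forall Q : {poly A}, map_poly f Q != 0 -> root (map_poly f Q) c ->
        (size P <= size (map_poly f Q))%N].

Lemma min_relation_ex (f : {rmorphism A -> L}) c P0 :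
  map_poly f P0 != 0 -> root (map_poly f P0) c -> exists P, min_relation f c P.
Proof.
pose sz n := `[< exists P : {poly A},
  [/\ map_poly f P != 0, root (map_poly f P) c & size (map_poly f P) = n] >].
move=> nzP0 rP0.
have exsz : exists n, sz n by exists (size (map_poly f P0)); apply/asboolP; exists P0.
case: (ex_minnP exsz) => m /asboolP [P [nzP rP szP]] minm.
(* Truncation removes the top coefficients that [f] kills. *)
pose Q := take_poly m P.
have fQ : map_poly f Q = map_poly f P.
  apply/polyP => i; rewrite !coef_map coef_take_poly; case: ltnP => // lemi.
  by rewrite raddf0 -coef_map nth_default // szP.
have m_gt0 : (0 < m)%N by rewrite -szP size_poly_gt0.
have lcQ : f Q`_m.-1 != 0.
  by rewrite -coef_map fQ -szP -lead_coefE lead_coef_eq0.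
have szQ : size Q = m.
  apply/eqP; rewrite eqn_leq size_take_poly /= -[X in (X <= _)%N](prednK m_gt0).
  by rewrite ltnNge; apply: contraNN lcQ => /(nth_default 0) ->; rewrite raddf0.
exists Q; split; rewrite ?fQ ?szP ?szQ //; first by rewrite lead_coefE szQ.
by move=> S nzS rS; apply: minm; apply/asboolP; exists S.
Qed.

(** The image of the pseudo-remainder also vanishes at [c] and is smaller than [P], so minimality
    makes it zero. *)
Lemma min_relation_modp (f : {rmorphism A -> L}) c P Q :
  min_relation f c P -> root (map_poly f Q) c -> map_poly f (Pdiv.Idomain.modp Q P) = 0.
Proof.
move=> [szP lcP rP minP] rQ; apply/eqP; apply: contraT => nz.
have nzP : P != 0 by rewrite -lead_coef_eq0; apply: contraNneq lcP => ->; rewrite raddf0.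
have : root (map_poly f (Pdiv.Idomain.modp Q P)) c.
  have /(congr1 (map_poly f)) := Pdiv.Idomain.divp_eq Q P.
  rewrite rmorphD rmorphM /= map_polyZ => /(congr1 (fun S => S.[c])) /eqP.
  rewrite hornerD hornerM hornerZ (rootP rQ) (rootP rP) !mulr0 add0r eq_sym.
  by rewrite /root.
move/(minP _ nz); rewrite leqNgt => /negP[].
apply: leq_ltn_trans (size_poly _ _) _.
by rewrite Pdiv.Idomain.ltn_modp.
Qed.

End MinimalRelation.

Section ExtendSameKernel.
Variables (A : idomainType) (L : closedFieldType) (f g : {rmorphism A -> L}).
Hypothesis kerfg : forall x, (f x == 0) = (g x == 0).

Lemma map_poly_same_kernel (P : {poly A}) : (map_poly f P == 0) = (map_poly g P == 0).
Proof.
by apply/eqP/eqP => /polyP h; apply/polyP => i; have := h i;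
   rewrite !coef_map !coef0 => /eqP; rewrite (kerfg, =^~ kerfg) => /eqP.
Qed.

(** By pseudo-division, [Q] times a power of the leading coefficient of [P] is a multiple of [P]
    modulo the common kernel, and [g] does not kill that leading coefficient. *)
Lemma root_transfer c c' P Q : min_relation f c P -> root (map_poly g P) c' ->
  root (map_poly f Q) c -> root (map_poly g Q) c'.
Proof.
move=> mP rP' rQ.
have := min_relation_modp mP rQ; move/eqP; rewrite map_poly_same_kernel => /eqP g0.
have /(congr1 (map_poly g)) := Pdiv.Idomain.divp_eq Q P.
rewrite rmorphD rmorphM /= map_polyZ g0 addr0 rmorphXn /= => /(congr1 (fun S => S.[c'])) /eqP.
rewrite hornerM hornerZ (rootP rP') mulr0 mulf_eq0 expf_eq0 -kerfg.
by case: mP => _ /negPf -> _ _; rewrite andbF.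
Qed.

(** With this the argument of [root_transfer] can be run from [g] back to [f]. *)
Lemma min_relation_transfer c c' P : min_relation f c P -> root (map_poly g P) c' ->
  min_relation g c' P.
Proof.
move=> mP rP'; have [szP lcP rP minP] := mP.
have glc : g (lead_coef P) != 0 by rewrite -kerfg.
have nzgP : map_poly g P != 0 by rewrite -lead_coef_eq0 lead_coef_map_eq.
have szgP : size (map_poly g P) = size P by rewrite size_map_poly_id0.
have [P' mP'] := min_relation_ex nzgP rP'; have [szP' lcP' rP'' minP'] := mP'.
have le : (size P' <= size P)%N by rewrite -szgP minP'.
split=> // Q nzQ rQ; apply: leq_trans (minP' _ nzQ rQ).
(* Otherwise [P' | P], and [c] would be a root of one of two smaller factors. *)
rewrite leqNgt; apply/negP => ltP'P.
have := min_relation_modp mP' rP'; move/eqP; rewrite -map_poly_same_kernel => /eqP f0.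
have /(congr1 (map_poly f)) := Pdiv.Idomain.divp_eq P P'.
rewrite rmorphD rmorphM /= map_polyZ f0 addr0 rmorphXn /= => eqf.
have flc' : f (lead_coef P') != 0 by rewrite kerfg.
set D := Pdiv.Idomain.divp _ _ in eqf.
have szfP' : size (map_poly f P') = size P' by rewrite size_map_poly_id0.
have nzfP : map_poly f P != 0 by rewrite map_poly_same_kernel.
have nzfP' : map_poly f P' != 0 by rewrite -lead_coef_eq0 lead_coef_map_eq.
have nzk k : f (lead_coef P') ^+ k != 0 by rewrite expf_neq0.
have nzD : map_poly f D != 0.
  apply: contraNneq nzfP => D0; move/eqP: eqf.
  by rewrite D0 mul0r scaler_eq0 (negPf (nzk _)).
have szDP : (size (map_poly f D) + size P' = (size P).+1)%N.
  have := size_mul nzD nzfP'; rewrite -eqf size_scale // szP szfP' => ->.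
  by rewrite prednK // addn_gt0 size_poly_gt0 nzD.
have P'gt1 : (1 < size P')%N by rewrite -szP'; apply: root_size_gt1 rP''; rewrite -map_poly_same_kernel.
move/(congr1 (fun S => S.[c])): eqf => /eqP.
rewrite hornerM hornerZ (rootP rP) mulr0 eq_sym mulf_eq0 => /orP[rD|rP'c].
  have := minP _ nzD rD; rewrite leqNgt => /negP[].
  by rewrite -(ltn_add2r (size P')) szDP -addn1 ltn_add2l.
by have := minP _ nzfP' rP'c; rewrite szfP' leqNgt ltP'P.
Qed.

(** If [c] is algebraic over the image of [f], any root of the [g]-image of its minimal relation
    serves as [c']; otherwise the transcendental [x] does. *)
Lemma extend_same_kernel :
  (exists x, forall P : {poly A}, map_poly g P != 0 -> (map_poly g P).[x] != 0) ->
  forall c, exists c', forall P : {poly A},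
    ((map_poly f P).[c] == 0) = ((map_poly g P).[c'] == 0).
Proof.
move=> [x xtr] c.
case: (pselect (exists P, map_poly f P != 0 /\ root (map_poly f P) c)); last first.
  move=> ntr; exists x => P; have [f0|nf0] := eqVneq (map_poly f P) 0.
    have /eqP := f0; rewrite map_poly_same_kernel => /eqP ->.
    by rewrite f0 !horner0 eqxx.
  rewrite (negPf (xtr _ _)) -?map_poly_same_kernel //; apply/negP => rP.
  by case: ntr; exists P.
case=> P0 [nzP0 rP0]; have [P mP] := min_relation_ex nzP0 rP0.
have [szP lcP rP _] := mP.
have [|c' rP'] := closed_rootP (map_poly g P) _.
  rewrite neq_ltn; apply/orP; right; rewrite size_map_poly_id0 -?kerfg // -szP.
  by apply: root_size_gt1 rP; rewrite -lead_coef_eq0 lead_coef_map_eq.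
have mP' := min_relation_transfer mP rP'.
exists c' => Q; apply/idP/idP => rQ; first exact: root_transfer mP rP' rQ.
have := min_relation_modp mP' rQ; move/eqP; rewrite -map_poly_same_kernel => /eqP f0.
have /(congr1 (map_poly f)) := Pdiv.Idomain.divp_eq Q P.
rewrite rmorphD rmorphM /= map_polyZ f0 addr0 rmorphXn /= => /(congr1 (fun S => S.[c])) /eqP.
rewrite hornerM hornerZ (rootP rP) mulr0 mulf_eq0 expf_eq0.
by rewrite (negPf lcP) andbF.
Qed.

End ExtendSameKernel.

(** * Multivariate relations, one variable at a time *)

Lemma mmap_comp n (A : comNzRingType) (B C : comNzRingType) (f : {rmorphism A -> B})
    (h : {rmorphism B -> C}) (v : 'I_n -> B) (P : {mpoly A[n]}) :
  h (mmap f v P) = mmap (h \o f) (h \o v) P.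
Proof.
rewrite /mmap rmorph_sum; apply: eq_bigr => m _; rewrite rmorphM /mmap1 rmorph_prod /=.
by congr (_ * _); apply: eq_bigr => i _; rewrite rmorphXn.
Qed.

Lemma eq_mmap n (A B : nzRingType) (f f' : A -> B) (v v' : 'I_n -> B) (P : {mpoly A[n]}) :
  f =1 f' -> v =1 v' -> mmap f v P = mmap f' v' P.
Proof.
move=> ef ev; apply: eq_bigr => m _; rewrite ef; congr (_ * _).
by apply: eq_bigr => i _; rewrite ev.
Qed.

Lemma meval_map_mpoly n (A B : comNzRingType) (f : {rmorphism A -> B}) (v : 'I_n -> B)
    (P : {mpoly A[n]}) : (map_mpoly f P).@[v] = mmap f v P.
Proof.
rewrite /map_mpoly (mmap_comp _ (meval v)); apply: eq_mmap => i /=.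
  by rewrite mevalC.
by rewrite mevalXU.
Qed.

Lemma mmap_muni n (A B : comNzRingType) (f : {rmorphism A -> B})
    (v : 'I_n.+1 -> B) (P : {mpoly A[n.+1]}) :
  mmap f v P =
  (map_poly (mmap f (fun i => v (widen_ord (leqnSn n) i))) (muni P)).[v ord_max].
Proof.
rewrite muniE rmorph_sum /= horner_sum; apply: eq_bigr => m _ /=.
rewrite map_polyZ map_polyXn hornerZ hornerXn /= mmapZ mmapX -mulrA; congr (_ * _).
rewrite {1}/mmap1 big_ord_recr /=; congr (_ * _); apply: eq_bigr => i _.
by rewrite mnmE.
Qed.

Lemma muni_eq0 n (A : comNzRingType) (P : {mpoly A[n.+1]}) : (muni P == 0) = (P == 0).
Proof.
apply/eqP/eqP => [P0|->]; last exact: muni0.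
(* [P] is recovered from [muni P] by evaluation at the variables. *)
have := mmap_muni (@mpolyC n.+1 A) (fun i => 'X_i) P.
rewrite P0 raddf0 horner0 => <-; rewrite [LHS]mpolyE; apply: eq_bigr => m _.
by rewrite mmap1_id mul_mpolyC.
Qed.

Lemma mmap_nvar0 (A B : comNzRingType) (f : {rmorphism A -> B}) v (P : {mpoly A[0]}) :
  mmap f v P = f P@_0%MM.
Proof. by rewrite {1}(nvar0_mpolyC P) mmapC. Qed.

(** Induction on [n]: evaluation at the first [n] entries gives two morphisms with the same kernel
    on the countable domain [{mpoly A[n]}], and [extend_same_kernel] adds the last entry. *)
Lemma extend_tuple (R : realType) (A : idomainType) (f g : {rmorphism A -> R[i]}) :
  encodable A -> (forall x, (f x == 0) = (g x == 0)) ->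
  forall n (c : 'I_n -> R[i]), exists c' : 'I_n -> R[i],
    forall P : {mpoly A[n]}, (mmap f c P == 0) = (mmap g c' P == 0).
Proof.
move=> encA kerfg; elim=> [|n IH] c.
  by exists c => P; rewrite !mmap_nvar0.
have [c' hc'] := IH (fun i => c (widen_ord (leqnSn n) i)).
have [x hx] := exists_transcendental (mmap g c') (encodable_mpoly n encA).
have [|y hy] := extend_same_kernel hc' _ (c ord_max); first by exists (real_complex R x).
exists (fun i => if unlift ord_max i is Some j then c' j else y) => P.
have eqmax j : lift ord_max j = widen_ord (leqnSn n) j.
  by apply: val_inj; rewrite /= /bump leqNgt ltn_ord.
rewrite !mmap_muni hy unlift_none.
set v := fun i => if unlift ord_max (widen_ord (leqnSn n) i) is Some j then c' j else y.
have eqv : mmap g v =1 mmap g c' by move=> Q; apply: eq_mmap => // i; rewrite /v -eqmax liftK.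
by rewrite (eq_map_poly eqv).
Qed.

Lemma exists_alg_indep (R : realType) n : exists c : 'I_n -> R,
  forall P : {mpoly rat[n]}, mmap (ratr : rat -> R) c P = 0 -> P = 0.
Proof.
elim: n => [|n [c hc]].
  exists (fun=> 0) => P; rewrite mmap_nvar0 => /eqP; rewrite fmorph_eq0 => /eqP P0.
  by rewrite (nvar0_mpolyC P) P0.
(* Evaluation at [c] is followed by the embedding into [R[i]], where [exists_transcendental] looks
   for roots. *)
pose g : {rmorphism {mpoly rat[n]} -> R[i]} := real_complex R \o mmap (ratr : rat -> R) c.
have gi : injective g.
  by apply: inj_comp => [|P Q /eqP]; [exact: fmorph_inj | rewrite -subr_eq0 -raddfB => /eqP/hc/eqP; rewrite subr_eq0 => /eqP].
have [x hx] := exists_transcendental g (encodable_mpoly n (encodable_countType rat)).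
exists (fun i => if unlift ord_max i is Some j then c j else x) => P P0.
apply/eqP; rewrite -muni_eq0; apply: contraT => nz.
have /hx/eqP[] : map_poly g (muni P) != 0.
  apply: contraNneq nz => /polyP h; apply/eqP/polyP => i; have := h i.
  by rewrite coef_map !coef0 -(raddf0 g) => /gi.
have eqmax j : lift ord_max j = widen_ord (leqnSn n) j.
  by apply: val_inj; rewrite /= /bump leqNgt ltn_ord.
move/(congr1 (real_complex R)): P0; rewrite raddf0 mmap_muni unlift_none -horner_map.
rewrite -map_poly_comp => <-; congr (_.[_]); apply: eq_map_poly => Q /=; congr (real_complex R _).
by apply: eq_mmap => // i; rewrite -eqmax liftK.
Qed.

Section Generic.
Variables (d : nat) (V : finType).

(** Variables of [mpoly] are indexed by ordinals; the enumeration is the one used in [alg_indep]. *)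
Definition coords (A : Type) (p : V -> 'I_d -> A) (i : 'I_#|{: V * 'I_d}|) : A :=
  p (enum_val i).1 (enum_val i).2.

Definition of_coords (A : Type) (c : 'I_#|{: V * 'I_d}| -> A) (v : V) (k : 'I_d) : A :=
  c (enum_rank (v, k)).

Lemma of_coordsK A (c : _ -> A) : coords (of_coords c) =1 c.
Proof. by move=> i; rewrite /coords /of_coords -surjective_pairing enum_valK. Qed.

Lemma coordsE A (p : V -> 'I_d -> A) v k : coords p (enum_rank (v, k)) = p v k.
Proof. by rewrite /coords enum_rankK. Qed.

Lemma genericP (F : numFieldType) (p : V -> 'I_d -> F) :
  generic p <-> forall P, mmap (ratr : rat -> F) (coords p) P = 0 -> P = 0.
Proof.
by split=> h P; [have := h P; rewrite meval_map_mpoly | rewrite meval_map_mpoly; exact: h].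
Qed.

Lemma generic_ex (R : realType) : exists p : V -> 'I_d -> R, generic p.
Proof.
have [c hc] := exists_alg_indep R #|{: V * 'I_d}|.
exists (of_coords c); apply/genericP => P P0; apply: hc; rewrite -P0.
by apply: eq_mmap => // i; rewrite of_coordsK.
Qed.

Lemma generic_complex (R : realType) (p : V -> 'I_d -> R) :
  generic p -> generic (fun v k => real_complex R (p v k)).
Proof.
move=> /genericP gp; apply/genericP => P P0; apply: gp.
apply/eqP; rewrite -(fmorph_eq0 (real_complex R)) (mmap_comp ratr) -P0; apply/eqP.
by apply: eq_mmap => // x /=; rewrite fmorph_rat.
Qed.

End Generic.

(** * Rigidity rows at a generic point *)

Section Rows.
Variables (A : comNzRingType) (T : finType) (n : nat).

Definition rows_mx (r : T -> 'rV[A]_n) (F : {set T}) : 'M[A]_(#|F|, n) :=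
  \matrix_(i < #|F|) r (enum_val i).

Definition gram (r : T -> 'rV[A]_n) (F : {set T}) : 'M[A]_#|F| :=
  rows_mx r F *m (rows_mx r F)^T.

Lemma mul_rows_mx (r : T -> 'rV[A]_n) F (lam : T -> A) :
  (\row_i lam (enum_val i)) *m rows_mx r F = \sum_(e in F) lam e *: r e.
Proof.
rewrite mulmx_sum_row [RHS]big_enum_val; apply: eq_bigr => i _.
by rewrite mxE rowK.
Qed.

End Rows.

Lemma map_rows_mx (A B : comNzRingType) (f : {rmorphism A -> B}) (T : finType) n
    (r : T -> 'rV[A]_n) F :
  map_mx f (rows_mx r F) = rows_mx (fun e => map_mx f (r e)) F.
Proof. by apply/matrixP => i j; rewrite !mxE. Qed.

Lemma map_gram (A B : comNzRingType) (f : {rmorphism A -> B}) (T : finType) n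
    (r : T -> 'rV[A]_n) F :
  map_mx f (gram r F) = gram (fun e => map_mx f (r e)) F.
Proof. by rewrite /gram map_mxM -matrix.map_trmx map_rows_mx. Qed.

Lemma eq_rows_mx (A : comNzRingType) (T : finType) n (r r' : T -> 'rV[A]_n) (F : {set T}) :
  {in F, r =1 r'} -> rows_mx r F = rows_mx r' F.
Proof. by move=> h; apply/row_matrixP => i; rewrite !rowK h ?enum_valP. Qed.

Lemma eq_gram (A : comNzRingType) (T : finType) n (r r' : T -> 'rV[A]_n) (F : {set T}) :
  {in F, r =1 r'} -> gram r F = gram r' F.
Proof. by move=> h; rewrite /gram (eq_rows_mx h). Qed.

Definition lin_indep (A : comNzRingType) (T : finType) n (r : T -> 'rV[A]_n) (F : {set T}) :=
  forall lam : T -> A, \sum_(e in F) lam e *: r e = 0 -> forall e, e \in F -> lam e = 0.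

(** A vector in the left kernel of the Gram matrix gives a combination of the rows with square norm
    zero, which vanishes over an ordered field. Independence thus becomes the nonvanishing of one
    polynomial in the entries. *)
Lemma lin_indep_gram (K : realFieldType) (T : finType) n (r : T -> 'rV[K]_n) F :
  lin_indep r F <-> \det (gram r F) != 0.
Proof.
split=> [indep|detn0 lam dep e eF]; last first.
  have : (\row_i lam (enum_val i)) *m gram r F = 0.
    by rewrite mulmxA mul_rows_mx dep mul0mx.
  move=> /(congr1 (mulmx^~ (invmx (gram r F)))).
  rewrite mul0mx mulmxK ?unitmxE ?unitfE // => /rowP /(_ (enum_rank_in eF e)).
  by rewrite !mxE enum_rankK_in.
apply/negP => /det0P [u u0 uG]; case/negP: u0.
have uM : u *m rows_mx r F = 0.
  have /matrixP/(_ 0 0) : (u *m rows_mx r F) *m (u *m rows_mx r F)^T = 0.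
    by rewrite trmx_mul mulmxA -(mulmxA u) uG mul0mx.
  rewrite mxE [RHS]mxE => /eqP; rewrite psumr_eq0 => [|j _]; last by rewrite [X in _ * X]mxE -expr2 sqr_ge0.
  move/allP => h; apply/rowP => j; have := h j (mem_index_enum _).
  by rewrite [X in _ * X]mxE -expr2 sqrf_eq0 => /eqP ->; rewrite mxE.
(* The kernel vector, extended by 0 outside [F]. *)
pose lam e := if [pick i | enum_val i == e :> T] is Some i then u 0 i else 0.
have lamE i : lam (enum_val i) = u 0 i.
  rewrite /lam; case: pickP => [j /eqP/enum_val_inj -> //|/(_ i)].
  by rewrite eqxx.
apply/eqP/rowP => i; rewrite -lamE mxE; apply: indep (enum_valP i).
by rewrite -mul_rows_mx -uM; congr (_ *m _); apply/rowP => j; rewrite mxE.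
Qed.

Section RigidityRows.
Variables (d : nat) (V : finType).

(** The row made of [rig_entry], over an arbitrary commutative ring: it is needed at formal points
    and has to commute with specialization. *)
Definition rigv (A : comNzRingType) (y : V -> 'I_d -> A) (e : {set V}) :
    'rV[A]_#|{: V * 'I_d}| :=
  \row_j coords (fun w k => if w \in e then \sum_(x in e :\ w) (y w k - y x k) else 0) j.

Lemma map_rigv (A B : comNzRingType) (f : {rmorphism A -> B}) y e :
  map_mx f (rigv y e) = rigv (fun v k => f (y v k)) e.
Proof.
apply/rowP => j; rewrite !mxE /coords; case: ifP => _; last exact: rmorph0.
by rewrite rmorph_sum; apply: eq_bigr => x _; rewrite rmorphB.
Qed.

Lemma eq_rigv (A : comNzRingType) (y y' : V -> 'I_d -> A) e :
  (forall v k, y v k = y' v k) -> rigv y e = rigv y' e.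
Proof.
move=> h; apply/rowP => j; rewrite !mxE /coords; case: ifP => // _.
by apply: eq_bigr => x _; rewrite !h.
Qed.

Lemma rows_indepP (R : realType) (p : V -> 'I_d -> R) F :
  rows_indep p F <-> lin_indep (rigv p) F.
Proof.
have E lam : (forall w k, \sum_(e in F) lam e * rig_entry p e w k = 0) <->
    \sum_(e in F) lam e *: rigv p e = 0.
  split=> [h|/rowP h w k].
    apply/rowP => j; rewrite summxE mxE -[RHS](h (enum_val j).1 (enum_val j).2).
    by apply: eq_bigr => e _; rewrite !mxE.
  apply: etrans (etrans (h (enum_rank (w, k))) _); rewrite ?summxE ?mxE //.
  by apply: eq_bigr => e _; rewrite !mxE coordsE.
by split=> h lam /E; exact: h.
Qed.

(** The formal point, of which every realization is a specialization. *)
Definition Xgen : V -> 'I_d -> {mpoly rat[#|{: V * 'I_d}|]} := of_coords (fun i => 'X_i).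

Lemma mmap_Xgen (A : comNzRingType) (f : {rmorphism rat -> A}) (y : V -> 'I_d -> A) v k :
  mmap f (coords y) (Xgen v k) = y v k.
Proof. by rewrite /Xgen /of_coords mmapX mmap1U coordsE. Qed.

Lemma map_rigv_Xgen (A : comNzRingType) (f : {rmorphism rat -> A}) y e :
  map_mx (mmap f (coords y)) (rigv Xgen e) = rigv y e.
Proof. by rewrite map_rigv; apply: eq_rigv => v k; exact: mmap_Xgen. Qed.

Lemma map_gram_Xgen (A : comNzRingType) (f : {rmorphism rat -> A}) y F :
  map_mx (mmap f (coords y)) (gram (rigv Xgen) F) = gram (rigv y) F.
Proof. by rewrite map_gram; apply: eq_gram => e _; rewrite map_rigv_Xgen. Qed.

(** No nonzero rational polynomial vanishes at a generic point, so the Gram determinant may be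
    tested at the formal point; all generic points therefore agree. *)
Lemma rows_indep_generic (R : realType) (p : V -> 'I_d -> R) F : generic p ->
  rows_indep p F <-> \det (gram (rigv Xgen) F) != 0.
Proof.
move=> /genericP gp; apply: iff_trans (rows_indepP p F) _.
apply: iff_trans (lin_indep_gram _ _) _.
rewrite -(map_gram_Xgen ratr) det_map_mx.
by split; apply: contraNneq; [move=> ->; rewrite rmorph0 | move=> /gp ->].
Qed.

Lemma rmat_indep_generic (R : realType) (p : V -> 'I_d -> R) F : generic p ->
  rmat_indep R d F <-> rows_indep p F.
Proof.
move=> gp; split=> [h|/(rows_indep_generic _ gp) h q gq]; first exact: h.
by apply/rows_indep_generic.
Qed.

(* Cramer's rule for the projection onto the span of the rows [F]: it holds at the
   generic point [p], hence identically. *)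
Lemma rigv_span_generic (R : realType) (p : V -> 'I_d -> R) (F : {set {set V}}) e (lam : {set V} -> R) :
  generic p -> rigv p e = \sum_(b in F) lam b *: rigv p b ->
  \det (gram (rigv Xgen) F) *: rigv Xgen e =
  rigv Xgen e *m (rows_mx (rigv Xgen) F)^T *m \adj (gram (rigv Xgen) F)
    *m rows_mx (rigv Xgen) F.
Proof.
move=> /genericP gp span; pose h := mmap (ratr : rat -> R) (coords p).
have mapE : map_mx h (rows_mx (rigv Xgen) F) = rows_mx (rigv p) F.
  by rewrite map_rows_mx; apply: eq_rows_mx => b _; rewrite map_rigv_Xgen.
set M := rows_mx (rigv Xgen) F in mapE *; set K := gram _ _; set r := rigv Xgen e.
have mapr : map_mx h r = rigv p e by rewrite map_rigv_Xgen.
have mapK : map_mx h K = rows_mx (rigv p) F *m (rows_mx (rigv p) F)^T by rewrite map_gram_Xgen.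
(* If a row is [lam *m M], then multiplying it by [M^T], by the adjugate of [M *m M^T] and by [M]
   gives [\det (M *m M^T)] times the row. *)
have eqh : map_mx h (\det K *: r) = map_mx h (r *m M^T *m \adj K *m M).
  rewrite map_mxZ !map_mxM map_mx_adj -matrix.map_trmx -det_map_mx mapE mapr mapK.
  rewrite span -mul_rows_mx -!mulmxA (mulmxA (rows_mx _ _) _^T) (mulmxA _ (\adj _)) mul_mx_adj.
  by rewrite mul_scalar_mx -scalemxAr.
apply/rowP => j; apply/eqP; rewrite -subr_eq0; apply/eqP/gp.
rewrite raddfB /=; move/rowP/(_ j): eqh; rewrite [LHS]mxE [RHS]mxE => eqh.
by apply/eqP; rewrite subr_eq0; apply/eqP.
Qed.

(* Twice the squared length of an edge, without a choice of its endpoints. *)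
Definition len2 (A : comNzRingType) (y : V -> 'I_d -> A) (e : {set V}) : A :=
  \sum_(u in e) \sum_(v in e) \sum_k (y u k - y v k) ^+ 2.

Lemma map_len2 (A B : comNzRingType) (f : {rmorphism A -> B}) y e :
  f (len2 y e) = len2 (fun v k => f (y v k)) e.
Proof.
rewrite /len2 !rmorph_sum; apply: eq_bigr => u _; rewrite rmorph_sum.
apply: eq_bigr => v _; rewrite rmorph_sum; apply: eq_bigr => k _.
by rewrite rmorphXn rmorphB.
Qed.

Lemma eq_len2 (A : comNzRingType) (y y' : V -> 'I_d -> A) (e : {set V}) :
  (forall v k, v \in e -> y v k = y' v k) -> len2 y e = len2 y' e.
Proof.
move=> h; apply: eq_bigr => u ue; apply: eq_bigr => v ve; apply: eq_bigr => k _.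
by rewrite !h.
Qed.

Lemma len2_sqlen (F : fieldType) (y : V -> 'I_d -> F) u v :
  u != v -> len2 y [set u; v] = 2 * sqlen y u v.
Proof.
move=> uv; have [s0 sC] : (forall w, \sum_k (y w k - y w k) ^+ 2 = 0) /\
    \sum_k (y v k - y u k) ^+ 2 = sqlen y u v.
  split=> [w|]; first by rewrite big1 // => k _; rewrite subrr expr0n.
  by apply: eq_bigr => k _; rewrite -sqrrN opprB.
rewrite /len2 !big_setU1 ?inE ?big_set1 //= !big_setU1 ?inE ?big_set1 //= !s0 sC.
by rewrite add0r addr0 mulr_natl mulr2n.
Qed.

End RigidityRows.

(** * Relations between the edge lengths of a direct sum *)

Section Derivation.
Variables (A : comNzRingType) (D : {additive A -> A}).
Hypothesis leibniz : forall x y, D (x * y) = D x * y + x * D y.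

Lemma derivation_sqr x : D (x ^+ 2) = 2 * x * D x.
Proof. by rewrite expr2 leibniz; ring. Qed.

(** The chain rule, stated for any derivation so as to cover both the derivative in [t] and the
    coefficientwise partial derivatives on polynomials in [t]. *)
Lemma derivation_mmap n (B : comNzRingType) (h : {rmorphism B -> A}) (v : 'I_n -> A)
    (P : {mpoly B[n]}) : (forall c, D (h c) = 0) ->
  D (mmap h v P) = \sum_i mmap h v P^`M(i) * D (v i).
Proof.
move=> Dh; pose Q (P : {mpoly B[n]}) :=
  D (mmap h v P) = \sum_i mmap h v P^`M(i) * D (v i).
have QC c : Q c%:MP.
  rewrite /Q mmapC Dh big1 // => i _; rewrite mderivC raddf0 mul0r //.
have QM P1 P2 : Q P1 -> Q P2 -> Q (P1 * P2).
  rewrite /Q => q1 q2; rewrite rmorphM leibniz q1 q2 mulr_suml mulr_sumr -big_split.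
  by apply: eq_bigr => i _; rewrite mderivM raddfD /= !rmorphM /=; ring.
have QX i : Q 'X_i.
  rewrite /Q mmapX mmap1U (bigD1 i) //= big1 => [|j ji].
    rewrite mderivX mnm1E eqxx /=.
    have -> : (U_(i) - U_(i) = 0 :> 'X_{1..n})%MM.
      by apply/mnmP => k; rewrite mnmBE subnn mnm0E.
    by rewrite mpolyX0 scale1r rmorph1 mul1r addr0.
  by rewrite mderivX mnm1E eq_sym (negPf ji) scale0r raddf0 mul0r.
have QXn m : Q 'X_[m].
  rewrite mpolyXE_id; apply: big_ind => [|//|i _]; first exact: QC 1.
  by elim: (m i) => [|k IH]; [exact: QC 1 | rewrite exprS; apply: QM].
rewrite -/(Q P); elim/mpolyind: P => [|c m P _ _ IH]; first exact: (QC 0).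
have := QM _ _ (QC c) (QXn m); rewrite mul_mpolyC /Q !raddfD /= => ->; rewrite IH -big_split.
by apply: eq_bigr => i _; rewrite mderivD raddfD /= mulrDl.
Qed.

(** The rigidity row is a gradient of the squared length: one factor 2 comes from the square, the
    other from [len2] counting each pair of endpoints twice. *)
Lemma derivation_len2 d (V : finType) (y : V -> 'I_d -> A) e :
  D (len2 y e) = 4 * \sum_j rigv y e 0 j * D (coords y j).
Proof.
(* The part of the derivative that falls on the first endpoint; exchanging the sums identifies the
   other part with it. *)
pose S := \sum_(u in e) \sum_(v in e) \sum_k (y u k - y v k) * D (y u k).
have -> : D (len2 y e) = 4 * S.
  have -> : D (len2 y e) = 2 * S +
      2 * \sum_(u in e) \sum_(v in e) \sum_k (y v k - y u k) * D (y v k).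
    rewrite /len2 /S raddf_sum !mulr_sumr -big_split; apply: eq_bigr => u _ /=.
    rewrite raddf_sum !mulr_sumr -big_split; apply: eq_bigr => v _ /=.
    rewrite raddf_sum !mulr_sumr -big_split; apply: eq_bigr => k _ /=.
    by rewrite derivation_sqr raddfB /=; ring.
  by rewrite [X in _ + 2 * X]exchange_big /= -/S; ring.
congr (_ * _); pose G (x : V * 'I_d) :=
  (if x.1 \in e then \sum_(v in e :\ x.1) (y x.1 x.2 - y v x.2) else 0) * D (y x.1 x.2).
transitivity (\sum_x G x); last first.
  rewrite (reindex (@enum_val _ [pred _ : V * 'I_d | true])) /=; last exact/onW_bij/enum_val_bij.
  by apply: eq_bigr => j _; rewrite mxE.
transitivity (\sum_w \sum_k G (w, k)); last first.
  by rewrite pair_bigA; apply: eq_bigr => -[].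
rewrite /S big_mkcond; apply: eq_bigr => u _; rewrite /G /=; case: ifP => ue; last first.
  by rewrite big1 // => k _; rewrite mul0r.
rewrite exchange_big; apply: eq_bigr => k _; rewrite (big_setD1 u) //= subrr mul0r add0r.
by rewrite mulr_suml.
Qed.

End Derivation.

(* Comparing the lowest nonzero coefficients of the two sides. *)
Lemma transport_eq0 (S : idomainType) (J : finType) (D : J -> {additive S -> S})
    (c F : {poly S}) (T : J -> {poly S}) :
  (forall n, n.+1%:R != 0 :> S) -> c`_0 != 0 -> F`_0 = 0 ->
  c * F^`() = \sum_j T j * map_poly (D j) F -> F = 0.
Proof.
move=> char0 c0 F0 eqF; apply/polyP => k; rewrite coef0.
elim/ltn_ind: k => -[//|k] IH.
have := congr1 (fun P : {poly S} => P`_k) eqF.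
rewrite coefM coef_sum [RHS]big1 => [|j _]; last first.
  rewrite coefM big1 // => i _; rewrite coef_map_id0 ?raddf0 // IH ?raddf0 ?mulr0 //.
  by rewrite ltnS leq_subr.
(* On the left only the product of the constant coefficient of [c] with coefficient [k] of the
   derivative remains; the other terms involve lower coefficients of [F]. *)
rewrite big_ord_recl big1 => [|i _].
  rewrite subn0 coef_deriv addr0 => /eqP.
  by rewrite -mulr_natr !mulf_eq0 (negPf c0) (negPf (char0 _)) orbF => /eqP.
rewrite coef_deriv IH ?mul0rn ?mulr0 // ltnS /= /bump /= add1n.
by rewrite subnSK // leq_subr.
Qed.

Section DirectSum.
Variables (R : realType) (d : nat) (V : finType) (p : V -> 'I_d -> R).
Variables (side : {set V} -> bool) (B : {set {set V}}) (N : nat) (edge : 'I_N -> {set V}).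
Hypothesis generic_p : generic p.
Hypothesis indepB : rows_indep p B.
Hypothesis spanB : forall i, exists lam : {set V} -> R,
  rigv p (edge i) = \sum_(b in [set b in B | side b == side (edge i)]) lam b *: rigv p b.
Variables y1 y2 : V -> 'I_d -> R.

Local Notation n := #|{: V * 'I_d}|.
Local Notation S := {mpoly R[n]}.
Local Notation A := {poly S}.

Let constS : {rmorphism rat -> S} := @mpolyC n R \o ratr.
Let constA : {rmorphism rat -> A} := polyC \o constS.

Let vel (s : bool) (v : V) (k : 'I_d) : S := if s then (y2 v k - y1 v k)%:MP else 0.
(* Both sides start at the formal point [X]; side [true] moves to [X + (y2 - y1)]. *)
Let yy (s : bool) (v : V) (k : 'I_d) : A := (of_coords (fun j => 'X_j) v k)%:P + (vel s v k)%:P * 'X.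
Let row_ (e : {set V}) := rigv (yy (side e)) e.
Let len_ (e : {set V}) := len2 (yy (side e)) e.

Let Dx (j : 'I_n) : {additive S -> S} := mderiv j.

(** Specialization at [t = 0] and [X = p], where both sides become the realization [p]. *)
Let at_p : {rmorphism A -> R} := meval (coords p) \o horner_eval (0 : S).

Let at_p_yy s v k : at_p (yy s v k) = p v k.
Proof.
by rewrite /at_p /= /horner_eval hornerD hornerM !hornerC hornerX mulr0 addr0 mevalXU coordsE.
Qed.

Let at_p_gram F : map_mx at_p (gram row_ F) = gram (rigv p) F.
Proof.
by rewrite map_gram; apply: eq_gram => e _; rewrite map_rigv; apply: eq_rigv => v k; exact: at_p_yy.
Qed.

(** The determinant specializes under [at_p] to the one at [p], where a subfamily of the independent
    [B] is independent. *)
Let gram_neq0 (F : {set {set V}}) : F \subset B -> \det (gram row_ F) != 0.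
Proof.
move=> /subsetP FB; have : \det (gram (rigv p) F) != 0.
  apply/lin_indep_gram => lam dep e eF.
  pose mu e := if e \in F then lam e else 0.
  have -> : lam e = mu e by rewrite /mu eF.
  apply: (iffLR (rows_indepP p B) indepB); last exact: FB.
  rewrite -[RHS]dep [RHS]big_mkcond [LHS]big_mkcond; apply: eq_bigr => b _; rewrite /mu.
  by case: ifPn => [|/negP bB]; case: ifPn => // bF; rewrite ?scale0r //; case: bB; exact: FB.
by apply: contraNneq => det0; rewrite -at_p_gram det_map_mx det0 rmorph0.
Qed.

Let Dt_len e : (len_ e)^`() = 4 * \sum_j row_ e 0 j * (coords (vel (side e)) j)%:P.
Proof.
rewrite /len_ (@derivation_len2 _ (@deriv S)); last exact: derivM.
congr (_ * _); apply: eq_bigr => j _; congr (_ * _).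
by rewrite /coords /yy /= derivD derivM !derivC derivX mul0r add0r mulr1 add0r.
Qed.

Let leibniz_Dx j (x z : A) :
  map_poly (Dx j) (x * z) = map_poly (Dx j) x * z + x * map_poly (Dx j) z.
Proof.
apply/polyP => i; rewrite coef_map_id0 ?raddf0 // coefD !coefM raddf_sum -big_split /=.
by apply: eq_bigr => l _; rewrite !coef_map_id0 ?raddf0 // -mderivM.
Qed.

Let Dx_yy i s v k : map_poly (Dx i) (yy s v k) = (i == enum_rank (v, k))%:R.
Proof.
rewrite /yy raddfD /= leibniz_Dx !map_polyC /= /vel.
have -> : mderiv i (if s then (y2 v k - y1 v k)%:MP_[n] else 0) = 0 :> S.
  by case: s; rewrite ?mderivC ?raddf0.
have -> : map_poly (mderiv i) ('X : A) = 0.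
  apply/polyP => l; rewrite coef_map_id0 ?raddf0 // coefX coef0.
  by case: eqP => _; rewrite ?raddf0 // (mderivC i 1).
rewrite mul0r mulr0 !addr0 /of_coords mderivX mnm1E eq_sym.
case: eqP => [->|_]; last by rewrite scale0r.
have -> : (U_(enum_rank (v, k)) - U_(enum_rank (v, k)) = 0 :> 'X_{1..n})%MM.
  by apply/mnmP => l; rewrite mnmBE subnn mnm0E.
by rewrite mpolyX0 scale1r.
Qed.

Let Dx_len j e : map_poly (Dx j) (len_ e) = 4 * row_ e 0 j.
Proof.
rewrite /len_ (@derivation_len2 _ (map_poly (Dx j))); last exact: leibniz_Dx.
congr (_ * _); rewrite (bigD1 j) //= big1 => [|i ij].
  by rewrite /coords Dx_yy -surjective_pairing enum_valK eqxx mulr1 addr0.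
by rewrite /coords Dx_yy -surjective_pairing enum_valK eq_sym (negPf ij) mulr0.
Qed.

Let speed e : A := \sum_j row_ e 0 j * (coords (vel (side e)) j)%:P.
Let c : A := \det (gram row_ B).
(** Cramer's rule on the Gram matrix: [T] is a single velocity of [X], common to both sides, under
    which the lengths of [B] change at [c] times their rate in [t]. *)
Let T : 'cV[A]_n :=
  (rows_mx row_ B)^T *m (\adj (gram row_ B) *m (\col_i speed (enum_val i))).

Let speedB b : b \in B -> c * speed b = \sum_j row_ b 0 j * T j 0.
Proof.
move=> bB; have : rows_mx row_ B *m T = c *: \col_i speed (enum_val i).
  by rewrite /T mulmxA mulmxA mul_mx_adj mul_scalar_mx.
move=> /matrixP/(_ (enum_rank_in bB b) 0); rewrite !mxE enum_rankK_in // => <-.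
by apply: eq_bigr => j _; rewrite mxE enum_rankK_in.
Qed.

(** This is where the direct sum is used. The row of [edge i] is a combination of rows of [B] on its
    own side, all taken at the same moving realization, so the identity for [B] extends to it. *)
Let speed_edge i : c * speed (edge i) = \sum_j row_ (edge i) 0 j * T j 0.
Proof.
set e := edge i; have [lam span] := spanB i.
set F := [set b in B | side b == side e] in span.
have FB : F \subset B by apply/subsetP => b; rewrite inE => /andP[].
pose h := mmap constA (coords (yy (side e))).
have hrow b : side b = side e -> map_mx h (rigv (@Xgen d V) b) = row_ b.
  by move=> sb; rewrite map_rigv_Xgen /row_ sb.
have hM : map_mx h (rows_mx (rigv (@Xgen d V)) F) = rows_mx row_ F.
  rewrite map_rows_mx; apply: eq_rows_mx => b; rewrite inE => /andP[_ /eqP sb].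
  exact: hrow.
have hG : map_mx h (gram (rigv (@Xgen d V)) F) = gram row_ F.
  by rewrite /gram map_mxM -matrix.map_trmx hM.
have /(congr1 (map_mx h)) := rigv_span_generic generic_p span.
rewrite map_mxZ map_mxM -det_map_mx hM hG hrow //; set a := map_mx h _ => cramer.
(* A linear functional on the row of [e] is determined by its values on the rows of [F], up to the
   nonzero Gram determinant. *)
have combo (w : 'I_n -> A) : \det (gram row_ F) * (\sum_j row_ e 0 j * w j) =
    \sum_i a 0 i * \sum_j row_ (enum_val i) 0 j * w j.
  have /(congr1 (fun r => (r *m \col_j w j) 0 0)) := cramer.
  rewrite -scalemxAl -mulmxA !mxE => E.
  transitivity (\det (gram row_ F) * (\sum_j row_ e 0 j * (\col_j w j) j 0)).
    by congr (_ * _); apply: eq_bigr => j _; rewrite mxE.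
  rewrite E; apply: eq_bigr => l _; congr (_ * _).
  by rewrite mxE; apply: eq_bigr => j _; rewrite !mxE.
apply: (mulfI (gram_neq0 FB)); rewrite combo mulrCA /speed combo mulr_sumr.
apply: eq_bigr => l _; have := enum_valP l; rewrite inE => /andP[bB /eqP sb].
by rewrite mulrCA -sb -/(speed _) speedB.
Qed.

Lemma direct_sum_vanish (P : {mpoly rat[N]}) :
  mmap (ratr : rat -> R) (fun i => len2 p (edge i)) P = 0 ->
  mmap (ratr : rat -> R)
    (fun i => len2 (if side (edge i) then y2 else y1) (edge i)) P = 0.
Proof.
move=> P0; pose Phi : A := mmap constA (fun i => len_ (edge i)) P.
have Phi0 : Phi = 0.
  apply: (@transport_eq0 _ _ Dx c _ (fun j => T j 0)).
  - by move=> k; rewrite -mpolyC_nat mpolyC_eq0 pnatr_eq0.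
  - have : \det (gram (rigv p) B) != 0 by apply/lin_indep_gram/rows_indepP.
    rewrite -at_p_gram det_map_mx; apply: contraNneq => c0.
    by rewrite /at_p /= /horner_eval horner_coef0 c0 raddf0.
  (* At [t = 0] the relation becomes a rational polynomial in the coordinates; it vanishes at the
     generic [p], hence identically. *)
  - pose Q : {mpoly rat[n]} := mmap (@mpolyC n rat) (fun i => len2 (@Xgen d V) (edge i)) P.
    have Q0 : Q = 0.
      have /genericP := generic_p; apply; rewrite -P0 /Q mmap_comp; apply: eq_mmap => x /=.
        by rewrite mmapC.
      by rewrite map_len2; apply: eq_len2 => v k _; exact: mmap_Xgen.
    have : mmap constS (fun j => 'X_j) Q = 0 by rewrite Q0 raddf0.
    rewrite -horner_coef0 -/(horner_eval 0 Phi) /Phi /Q !mmap_comp; apply: etrans.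
    apply: eq_mmap => x /=; first by rewrite mmapC /horner_eval hornerC.
    rewrite !map_len2; apply: eq_len2 => v k _.
    rewrite /= /horner_eval /yy hornerD hornerM !hornerC hornerX mulr0 addr0.
    by rewrite /Xgen /of_coords /= mmapX mmap1U.
    (* The transport equation: the chain rule in [t] and in each [X_j] reduces it to [speed_edge],
       edge by edge. *)
    rewrite /Phi (@derivation_mmap _ (@deriv S)); last 2 first.
    + exact: derivM.
    + by move=> x; exact: derivC.
    under [RHS]eq_bigr => j _.
      rewrite (@derivation_mmap _ (map_poly (Dx j))); last 2 first.
      - exact: leibniz_Dx.
      - by move=> x; rewrite /constA /= map_polyC /= mderivC.
      over.
    rewrite mulr_sumr; under [RHS]eq_bigr => j _ do rewrite mulr_sumr.
    rewrite exchange_big; apply: eq_bigr => i _ /=.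
    rewrite Dt_len -/(speed _) !mulrA (mulrAC _ _ (speed _)) (mulrAC c) speed_edge.
    rewrite !mulr_suml; apply: eq_bigr => j _.
    by rewrite Dx_len; ring.
(* At [X = y1] and [t = 1], side [false] is at [y1] and side [true] has arrived at [y2]. *)
pose at_y : {rmorphism A -> R} := meval (coords y1) \o horner_eval (1 : S).
have : at_y Phi = 0 by rewrite Phi0 rmorph0.
rewrite /Phi mmap_comp => <-; apply: eq_mmap => x.
  by rewrite /at_y /= /horner_eval hornerC mevalC.
rewrite /comp map_len2; apply: eq_len2 => v k _.
rewrite /at_y /= /horner_eval /yy hornerD hornerM !hornerC hornerX mulr1 raddfD /= mevalXU coordsE /vel.
by case: (side _); rewrite ?raddf0 ?addr0 // mevalC addrC subrK.
Qed.

End DirectSum.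

(** * Circuits of a linear matroid *)

Section LinearMatroid.
Variables (K : fieldType) (T : finType) (n : nat) (r : T -> 'rV[K]_n).
Implicit Types (u w z lam : T -> K) (E F : {set T}).

Definition supp lam : {set T} := [set e | lam e != 0].

Definition dependency lam := \sum_e lam e *: r e = 0.

(** The supports of these vectors are the circuits of the matroid. *)
Definition elementary u :=
  [/\ dependency u, supp u != set0 &
      forall w, dependency w -> supp w \proper supp u -> supp w = set0].

Lemma dependency_comb a b u w : dependency u -> dependency w ->
  dependency (fun e => a * u e + b * w e).
Proof.
move=> du dw; rewrite /dependency.
under eq_bigr => e _ do rewrite scalerDl -!scalerA.
by rewrite big_split /= -!scaler_sumr du dw !scaler0 addr0.
Qed.

Lemma lin_indep_supp F :
  lin_indep r F <-> forall lam, dependency lam -> supp lam \subset F -> supp lam = set0.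
Proof.
split=> [indep lam dep /subsetP sub|h lam dep e eF].
  apply: contrapT => /eqP/set0Pn[e es]; have := es; rewrite inE => /eqP[].
  apply: (indep lam _ e); last exact: sub.
  rewrite -[RHS]dep big_mkcond; apply: eq_bigr => b _; case: ifPn => // /negP bF.
  have [->|nzb] := eqVneq (lam b) 0; first by rewrite scale0r.
  by case: bF; apply: sub; rewrite inE.
pose mu b := if b \in F then lam b else 0.
have : supp mu = set0.
  apply: h; last by apply/subsetP => b; rewrite inE /mu; case: ifP => //; rewrite eqxx.
  rewrite /dependency -[RHS]dep [RHS]big_mkcond; apply: eq_bigr => b _; rewrite /mu.
  by case: ifP => //; rewrite scale0r.
by move=> /setP/(_ e); rewrite !inE /mu eF => /negbFE/eqP.
Qed.

(** Induction on the support: a dependency [w] of smaller support either contains [e] and replaces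
    [z], or a multiple of it is subtracted from [z] to shrink the support while keeping [e]. *)
Lemma elementary_through z e : dependency z -> z e != 0 ->
  exists u, [/\ elementary u, supp u \subset supp z & u e != 0].
Proof.
have [m] := ubnP #|supp z|; elim: m z => // m IH z ltm dz ze.
have [elz|nelz] := pselect (elementary z); first by exists z; split.
have [w [dw sw sw0]] : exists w, [/\ dependency w, supp w \proper supp z & supp w != set0].
  apply: contrapT => h; apply: nelz; split=> // [|w dw sw].
    by apply/set0Pn; exists e; rewrite inE.
  by apply/eqP; apply: contraT => sw0; case: h; exists w.
have [we|we] := eqVneq (w e) 0; last first.
  have [u [elu su ue]] := IH w (leq_trans (proper_card sw) ltm) dw we.
  by exists u; split=> //; exact: subset_trans su (proper_sub sw).
case/set0Pn: sw0 => h; rewrite inE => wh.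
pose z' x := 1 * z x + (- (z h / w h)) * w x.
have sz' : supp z' \proper supp z.
  apply/properP; split.
    apply/subsetP => x; rewrite !inE; apply: contraNneq => zx.
    have : x \notin supp w by apply/negP => /(subsetP (proper_sub sw)); rewrite inE zx eqxx.
    by rewrite inE negbK /z' zx => /eqP ->; rewrite !mulr0 addr0.
  exists h; first by apply: (subsetP (proper_sub sw)); rewrite inE.
  by rewrite inE /z' mul1r mulNr divfK // subrr eqxx.
have [|||u [elu su ue]] := IH z'.
- exact: leq_trans (proper_card sz') ltm.
- exact: dependency_comb.
- by rewrite /z' we mulr0 addr0 mul1r.
by exists u; split=> //; exact: subset_trans su (proper_sub sz').
Qed.

(* One half of strong circuit elimination. *)
Lemma elementary_elim u w e g : elementary u -> elementary w ->
  u e != 0 -> w e = 0 -> u g != 0 -> w g != 0 ->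
  exists c h, [/\ elementary c, supp c \subset (supp u :|: supp w) :\ g, c e != 0,
    c h != 0 & (u h == 0) && (w h != 0)].
Proof.
move=> elu elw ue we ug wg; pose z x := w g * u x + (- u g) * w x.
have dz : dependency z by apply: dependency_comb; [case: elu | case: elw].
have ze : z e != 0 by rewrite /z we mulr0 addr0 mulf_neq0.
have sz : supp z \subset (supp u :|: supp w) :\ g.
  apply/subsetP => x; rewrite !inE => zx; apply/andP; split.
    by apply: contraNneq zx => ->; rewrite /z mulNr mulrC subrr.
  rewrite -negb_and; apply: contraNN zx => /andP[/eqP ux /eqP wx].
  by rewrite /z ux wx !mulr0 addr0.
have [c [elc sc ce]] := elementary_through dz ze.
have {}sc := subset_trans sc sz.
(* Otherwise the support of [c] would lie in that of [u] and miss [g], against the minimality of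
   [u]. *)
have [h ch uh] : exists2 h, c h != 0 & u h == 0.
  apply: contrapT => nh; have [_ _ minu] := elu; have [dc c0 _] := elc.
  case/negP: c0; apply/eqP/minu => //; apply/properP; split.
    apply/subsetP => x; rewrite !inE => cx; apply/negP => ux; apply: nh.
    by exists x.
  exists g; first by rewrite inE.
  by apply/negP => /(subsetP sc); rewrite !inE eqxx.
exists c, h; split=> //; rewrite uh /=.
have hc : h \in supp c by rewrite inE.
by move/(subsetP sc): hc; rewrite !inE uh => /andP[].
Qed.

(** Induction on the size of the union of the supports. Eliminating [g] in both ways gives [c]
    through [e] and [c'] through [f]. Either [c] and [w] have a smaller union, or [c] contains a
    point [h'] of [c'], and the union of these two misses [g]. *)
Lemma elementary_connect u w e f g : elementary u -> elementary w ->
  u e != 0 -> w f != 0 -> u g != 0 -> w g != 0 ->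
  exists c, [/\ elementary c, supp c \subset supp u :|: supp w, c e != 0 & c f != 0].
Proof.
have [m] := ubnP #|supp u :|: supp w|.
elim: m u w g => // m IH u w g ltm elu elw ue wf ug wg.
have [we|we] := eqVneq (w e) 0; last by exists w; split=> //; exact: subsetUr.
have [uf|uf] := eqVneq (u f) 0; last by exists u; split=> //; exact: subsetUl.
have [c [h [elc sc ce ch /andP[_ wh]]]] := elementary_elim elu elw ue we ug wg.
have [c' [h' [elc' sc' cf' ch' /andP[wh' uh']]]] := elementary_elim elw elu wf uf wg ug.
rewrite setUC in sc'.
have sub_cw : supp c :|: supp w \subset supp u :|: supp w.
  by rewrite subUset subsetUr andbT (subset_trans sc) // subD1set.
have [ltc|] := boolP (supp c :|: supp w \proper supp u :|: supp w).
  have [v [elv sv ve vf]] := IH c w h (leq_trans (proper_card ltc) ltm) elc elw ce wf ch wh.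
  by exists v; split=> //; exact: subset_trans sv sub_cw.
rewrite properE sub_cw negbK => /subsetP sup.
have ch'0 : c h' != 0.
  have : h' \in supp c :|: supp w by apply: sup; rewrite !inE uh'.
  by rewrite !inE wh' orbF.
have sub2 : supp c :|: supp c' \subset (supp u :|: supp w) :\ g.
  by rewrite subUset sc.
have lt2 : (#|supp c :|: supp c'| < #|supp u :|: supp w|)%N.
  apply: leq_ltn_trans (subset_leq_card sub2) _.
  by rewrite [X in (_ < X)%N](cardsD1 g) !inE ug.
have [v [elv sv ve vf]] := IH c c' h' (leq_trans lt2 ltm) elc elc' ce cf' ch'0 ch'.
by exists v; split=> //; apply: subset_trans sv (subset_trans sub2 (subD1set _ _)).
Qed.

Lemma max_indep E : exists B : {set T}, [/\ B \subset E, lin_indep r B &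
  forall e, e \in E -> exists lam, r e = \sum_(b in B) lam b *: r b].
Proof.
pose P (B : {set T}) := (B \subset E) && `[< lin_indep r B >].
have [|B /maxsetP[/andP[BE /asboolP indB] maxB]] := @ex_maxset _ P.
  by exists set0; rewrite /P sub0set; apply/asboolP => lam _ e; rewrite inE.
exists B; split=> // e eE; have [eB|eB] := boolP (e \in B).
  exists (fun b => (b == e)%:R); rewrite (bigD1 e) //= eqxx scale1r big1 ?addr0 //.
  by move=> b /andP[_ /negPf ->]; rewrite scale0r.
have : ~ lin_indep r (e |: B).
  move=> ind; case/negP: eB; rewrite -(maxB (e |: B)) ?setU11 ?subsetUr //.
  by rewrite /P subUset sub1set eE BE; apply/asboolP.
move=> /existsNP[lam /not_implyP[dep nz]]; rewrite big_setU1 //= in dep.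
have lame : lam e != 0.
  apply/eqP => le; apply: nz => b; rewrite !inE => /orP[/eqP -> //|bB].
  by apply: indB bB; rewrite -[RHS]dep le scale0r add0r.
exists (fun b => - (lam e)^-1 * lam b).
under eq_bigr => b _ do rewrite -scalerA.
rewrite -scaler_sumr scaleNr -scalerN; apply: (scalerI lame).
by rewrite scalerA divff // scale1r; apply/eqP; rewrite -subr_eq0 opprK dep.
Qed.

(** [S] consists of [e] and all elements on a common circuit with it. By [elementary_connect] no
    circuit inside [E] crosses its boundary, so bases of [S] and of its complement form a basis
    together. *)
Lemma separation E e f : e \in E -> f \in E -> e != f ->
  (forall u, elementary u -> supp u \subset E -> u e != 0 -> u f = 0) ->
  exists S B : {set T}, [/\ e \in S, f \notin S, S \subset E, lin_indep r B &
    forall g, g \in E -> exists lam,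
      r g = \sum_(b in [set b in B | (b \in S) == (g \in S)]) lam b *: r b].
Proof.
move=> eE fE ef nconn.
pose conn g := exists u, [/\ elementary u, supp u \subset E, u e != 0 & u g != 0].
pose S := [set g in E | (g == e) || `[< conn g >]].
have connS u g h : elementary u -> supp u \subset E -> g \in S -> u g != 0 -> u h != 0 -> h \in S.
  rewrite !inE => elu su /andP[_ gS] ug uh.
  have -> : h \in E by apply: (subsetP su); rewrite inE.
  apply/orP; right; apply/asboolP.
  case/orP: gS => [/eqP eg|/asboolP [w [elw sw we wg]]].
    by exists u; rewrite -eg.
  have [c [elc sc ce ch]] := elementary_connect elw elu we uh wg ug.
  by exists c; split=> //; rewrite (subset_trans sc) // subUset sw.
pose restr u := fun x => if x \in S then u x else 0.
(* Elementary vectors are subtracted one at a time; by [connS] each has its support inside [S] or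
   outside it. *)
have dep_restr lam : dependency lam -> supp lam \subset E -> dependency (restr lam).
  have [m] := ubnP #|supp lam|; elim: m lam => // m IH lam ltm dl sl.
  have [s0|/set0Pn[h]] := eqVneq (supp lam) set0.
    rewrite /dependency big1 // => x _; rewrite /restr.
    move/setP/(_ x): s0; rewrite !inE => /negbFE/eqP ->.
    by case: ifP; rewrite scale0r.
  rewrite inE => lh; have [u [elu su uh]] := elementary_through dl lh.
  have [du _ _] := elu.
  pose lam' x := 1 * lam x + (- (lam h / u h)) * u x.
  have sl' : supp lam' \proper supp lam.
    apply/properP; split.
      apply/subsetP => x; rewrite !inE; apply: contraNneq => zx.
      have : x \notin supp u by apply/negP => /(subsetP su); rewrite inE zx eqxx.
      by rewrite inE negbK /lam' zx => /eqP ->; rewrite !mulr0 addr0.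
    by exists h; rewrite inE // /lam' mul1r mulNr divfK // subrr eqxx.
  have dr' : dependency (restr lam').
    apply: IH; first exact: leq_trans (proper_card sl') ltm.
      exact: dependency_comb.
    exact: subset_trans (proper_sub sl') sl.
  have dru : dependency (restr u).
    have suE := subset_trans su sl.
    have [hS|hS] := boolP (h \in S).
      rewrite /dependency -[RHS]du; apply: eq_bigr => x _; rewrite /restr.
      case: ifPn => // xS; have [->//|ux] := eqVneq (u x) 0.
      by rewrite (connS u h x) in xS.
    rewrite /dependency big1 // => x _; rewrite /restr; case: ifPn => [xS|]; rewrite ?scale0r //.
    have [->|ux] := eqVneq (u x) 0; first by rewrite scale0r.
    by rewrite (connS u x h) in hS.
  have := dependency_comb 1 (lam h / u h) dr' dru; rewrite /dependency => E0.
  rewrite -[RHS]E0; apply: eq_bigr => x _; congr (_ *: _); rewrite /restr /lam'.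
  by case: ifP => _; [rewrite !mul1r mulNr subrK | rewrite !mulr0 addr0].
have eS : e \in S by rewrite inE eE eqxx.
have fS : f \notin S.
  rewrite inE fE eq_sym (negPf ef) /=; apply/asboolP => -[u [elu su ue uf]].
  by rewrite (nconn u) ?eqxx in uf.
have SE : S \subset E by apply/subsetP => x; rewrite inE => /andP[].
clearbody S.
have [B1 [B1S ind1 span1]] := max_indep S.
have [B2 [B2S ind2 span2]] := max_indep (E :\: S).
exists S, (B1 :|: B2); split=> //.
- apply/lin_indep_supp => lam dl sl.
  have slE : supp lam \subset E.
    apply: subset_trans sl _; rewrite subUset (subset_trans B1S SE) /=.
    exact: subset_trans B2S (subsetDl _ _).
  have dr := dep_restr _ dl slE.
  have s1 : supp (restr lam) = set0.
    apply: (iffLR (lin_indep_supp B1) ind1) => //; apply/subsetP => x.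
    rewrite inE /restr; case: ifP => [xS lx|]; last by rewrite eqxx.
    have /(subsetP sl) : x \in supp lam by rewrite inE.
    by rewrite inE => /orP[//|/(subsetP B2S)]; rewrite inE xS.
  apply: (iffLR (lin_indep_supp B2) ind2) => //; apply/subsetP => x xl.
  move/(subsetP sl): (xl); rewrite inE => /orP[/(subsetP B1S) xS|//].
  move/setP/(_ x): s1; rewrite !inE /restr xS; rewrite inE in xl.
  by rewrite xl.
- move=> g gE; have [gS|gS] := boolP (g \in S).
    have [lam ->] := span1 g gS; exists lam; apply: eq_bigl => b; rewrite !inE eqb_id.
    apply/idP/andP => [bB|[/orP[//|/(subsetP B2S)]]]; last by rewrite inE => /andP[/negPf ->].
    by rewrite bB; split=> //; exact: (subsetP B1S).
  have [|lam ->] := span2 g; first by rewrite inE gS.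
  exists lam; apply: eq_bigl => b; rewrite !inE eqbF_neg.
  apply/idP/andP => [bB|[/orP[/(subsetP B1S) -> //|//]]].
  by rewrite bB orbT; split=> //; move/(subsetP B2S): bB; rewrite inE => /andP[].
Qed.

End LinearMatroid.

(** * Generic realizations with prescribed edge lengths *)

Lemma mmap_map_mpoly n (A B C : comNzRingType) (f : {rmorphism B -> C})
    (h : {rmorphism A -> B}) (v : 'I_n -> C) (P : {mpoly A[n]}) :
  mmap f v (map_mpoly h P) = mmap (f \o h) v P.
Proof.
rewrite /map_mpoly (mmap_comp _ (mmap f v)); apply: eq_mmap => i /=.
  by rewrite mmapC.
by rewrite mmapX mmap1U.
Qed.

Lemma len2_imset d (V W : finType) (A : comNzRingType) (q : W -> 'I_d -> A) (g : V -> W)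
    (e : {set V}) : {in e &, injective g} -> len2 q (g @: e) = len2 (fun v => q (g v)) e.
Proof.
move=> gi; rewrite /len2 big_imset //=; apply: eq_bigr => u _.
by rewrite big_imset.
Qed.

Lemma len2_translate d (V : finType) (A : comNzRingType) (y : V -> 'I_d -> A) c e :
  len2 (fun v k => y v k + c k) e = len2 y e.
Proof.
apply: eq_bigr => u _; apply: eq_bigr => v _; apply: eq_bigr => k _.
by congr (_ ^+ 2); ring.
Qed.

Section Realize.
Variables (R : realType) (d : nat) (W : finType) (N : nat).
Variables (l : forall A : comNzRingType, (W -> 'I_d -> A) -> 'I_N -> A).
Hypothesis l_morph : forall (A B : comNzRingType) (f : {rmorphism A -> B}) y i,
  f (l y i) = l (fun w k => f (y w k)) i.
Hypothesis l_ext : forall (A : comNzRingType) (y y' : W -> 'I_d -> A) i,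
  (forall w k, y w k = y' w k) -> l y i = l y' i.

(** Take formal lengths as coefficients: evaluating them at [l q0] and at [b] has the same kernel,
    so [extend_tuple] carries the coordinates of [q0] to a tuple [q] with the same relations.
    Genericity and the length equations are both such relations. *)
Lemma generic_realization (q0 : W -> 'I_d -> R) (b : 'I_N -> R) : generic q0 ->
  (forall P, mmap (ratr : rat -> R) (l q0) P = 0 <-> mmap (ratr : rat -> R) b P = 0) ->
  exists q : W -> 'I_d -> R[i], generic q /\ forall i, l q i = real_complex R (b i).
Proof.
move=> gq0 same; pose rc : {rmorphism R -> R[i]} := real_complex R.
have toC v (P : {mpoly rat[N]}) :
    mmap (ratr : rat -> R[i]) (rc \o v) P = rc (mmap (ratr : rat -> R) v P).
  by rewrite mmap_comp; apply: eq_mmap => // x /=; rewrite fmorph_rat.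
pose f := mmap (ratr : rat -> R[i]) (rc \o l q0).
pose g := mmap (ratr : rat -> R[i]) (rc \o b).
have kerfg x : (f x == 0) = (g x == 0).
  by rewrite /f /g !toC !fmorph_eq0; apply/eqP/eqP => /same.
pose qC w k := rc (q0 w k).
have [c hc] := extend_tuple (encodable_mpoly N (encodable_countType rat)) kerfg (coords qC).
exists (of_coords c); split.
  apply/genericP => P P0; have /genericP := generic_complex gq0; apply.
  have := hc (map_mpoly (@mpolyC N rat) P); rewrite !mmap_map_mpoly => e.
  have E v (h : {rmorphism {mpoly rat[N]} -> R[i]}) : mmap (h \o @mpolyC N rat) v P = mmap ratr v P.
    by apply: eq_mmap => // x; exact: (fmorph_eq_rat (h \o @mpolyC N rat)).
  apply/eqP; rewrite -(E _ f) e E -P0; apply/eqP; apply: eq_mmap => // i.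
  by rewrite of_coordsK.
move=> i.
(* The relation to transfer: length [i] of the formal point equals the [i]-th coefficient
   variable. *)
pose X : W -> 'I_d -> {mpoly {mpoly rat[N]}[#|{: W * 'I_d}|]} := of_coords (fun j => 'X_j).
have XE (h : {rmorphism {mpoly rat[N]} -> R[i]}) v w k : mmap h v (X w k) = of_coords v w k.
  by rewrite /X /of_coords mmapX mmap1U.
have E (h : {rmorphism {mpoly rat[N]} -> R[i]}) v :
    mmap h v (l X i - ('X_i)%:MP) = l (of_coords v) i - h 'X_i.
  rewrite raddfB /= (l_morph (mmap h v)) mmapC; congr (_ - _).
  by apply: l_ext => w k; exact: XE.
have := hc (l X i - ('X_i)%:MP); rewrite (E f) (E g) /= !mmapX !mmap1U /=.
have -> : l (of_coords (coords qC)) i = rc (l q0 i).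
  by rewrite l_morph; apply: l_ext => w k; rewrite /of_coords coordsE.
by rewrite subrr eqxx => /esym; rewrite subr_eq0 => /eqP.
Qed.

End Realize.

(** * Regluing the two sides into another graph *)

Section Reglue.
Variables (R : realType) (d : nat) (V : finType) (E S B : {set {set V}}) (p : V -> 'I_d -> R).
Hypotheses (simpleE : simple_graph E) (recE : fully_reconstructible R d E).
Hypotheses (generic_p : generic p) (indepB : rows_indep p B).
Hypothesis spanB : forall e, e \in E -> exists lam : {set V} -> R,
  rigv p e = \sum_(b in [set b in B | (b \in S) == (e \in S)]) lam b *: rigv p b.

(** The new edges are the sets [g (e \in S) @: e]. The hypotheses abstract what splitting and
    identifying vertices share: each side is embedded, edges of different sides meet in at most one
    vertex, and two independent realizations of the sides combine into one of [W] up to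
    congruence. *)
Variables (W : finType) (g : bool -> V -> W).
Hypothesis g_inj : forall e e' x y, e \in E -> e' \in E -> (e \in S) = (e' \in S) ->
  x \in e -> y \in e' -> g (e \in S) x = g (e \in S) y -> x = y.
Hypothesis g_meet : forall e e' x x' y y', e \in E -> e' \in E -> e \in S -> e' \notin S ->
  x \in e -> x' \in e -> y \in e' -> y' \in e' ->
  g true x = g false y -> g true x' = g false y' -> y = y'.
Hypothesis g_cover : forall w, exists e v, [/\ e \in E, v \in e & w = g (e \in S) v].
Hypothesis g_lift : forall y1 y2 : V -> 'I_d -> R, exists q : W -> 'I_d -> R,
  forall e, e \in E -> len2 (fun v => q (g (e \in S) v)) e = len2 (if e \in S then y2 else y1) e.

Lemma regluing_card : #|V| = #|W|.
Proof.
pose psi e := g (e \in S) @: e; pose edge (i : 'I_#|E|) := enum_val i.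
have edgeE i : edge i \in E by exact: enum_valP.
have ginj e : e \in E -> {in e &, injective (g (e \in S))}.
  by move=> eE x y xe ye; exact: (@g_inj e e).
have card_psi e : e \in E -> #|psi e| = 2.
  by move=> eE; rewrite card_in_imset ?simpleE //; exact: ginj.
(* Edges of the same side are separated by [g_inj]; edges of different sides cannot share both
   endpoints, by [g_meet]. *)
have psi_sub e e' : e \in E -> e' \in E -> psi e = psi e' -> e \subset e'.
  move=> eE e'E eqp; apply/subsetP => x xe.
  have [side|side] := eqVneq (e \in S) (e' \in S).
    have : g (e \in S) x \in psi e' by rewrite -eqp imset_f.
    by case/imsetP => y ye'; rewrite -side => /(g_inj eE e'E side xe ye') ->.
  have key a b : a \in E -> b \in E -> psi a = psi b -> a \in S -> b \notin S -> False.
    move=> aE bE eqab aS bS; have /card_gt1P [y [y' [yb y'b]]] : (1 < #|b|)%N by rewrite simpleE.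
    have pre z : z \in b -> exists2 x, x \in a & g true x = g false z.
      move=> zb; have : g (b \in S) z \in psi a by rewrite eqab imset_f.
      by case/imsetP => t ta; rewrite aS (negPf bS) => ->; exists t.
    have [[t ta et] [t' t'a et']] := (pre y yb, pre y' y'b).
    by rewrite (g_meet aE bE aS bS ta t'a yb y'b et et') eqxx.
  case eS : (e \in S) side; case e'S : (e' \in S) => // _.
    by case: (key e e'); rewrite ?e'S.
  by case: (key e' e); rewrite ?eS.
pose l (A : comNzRingType) (y : W -> 'I_d -> A) i := len2 (fun v => y (g (edge i \in S) v)) (edge i).
have [q0 gq0] := generic_ex d W R.
have [||P|q [gq hq]] := @generic_realization R d W #|E| l _ _ q0 (fun i => len2 p (edge i)) gq0.
- by move=> A A' f y i; rewrite /l map_len2.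
- by move=> A y y' i h; apply: eq_len2 => v k _; exact: h.
(* Relations of the lengths of [p] pass to those of [q0] by [direct_sum_vanish]. *)
- split=> P0; last first.
    have span i := spanB (edgeE i).
    have := direct_sum_vanish generic_p indepB span (fun v => q0 (g false v)) (fun v => q0 (g true v)) P0.
    move=> <-; apply: eq_mmap => // i; rewrite /l; apply: eq_len2 => v k _.
    by case: (edge i \in S).
  (* Conversely, a relation at the generic [q0] is an identity in the coordinates, so it holds at a
     realization with the lengths of [p]. *)
  have [q hq] := g_lift p p.
  pose Q := mmap (@mpolyC _ rat) (l _ (@Xgen d W)) P.
  have evalQ (y : W -> 'I_d -> R) : mmap ratr (coords y) Q = mmap ratr (l _ y) P.
    rewrite /Q mmap_comp; apply: eq_mmap => x /=; first by rewrite mmapC.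
    by rewrite map_len2; apply: eq_len2 => v k _; exact: mmap_Xgen.
  have Q0 : Q = 0 by have /genericP := gq0; apply; rewrite evalQ.
  have := evalQ q; rewrite Q0 raddf0 => ->; apply: eq_mmap => // i.
  by rewrite /l hq //; case: ifP.
pose pC v k := real_complex R (p v k).
have lenE e : e \in E -> len2 q (psi e) = len2 pC e.
  move=> eE; rewrite len2_imset; last exact: ginj.
  by have := hq (enum_rank_in eE e); rewrite /l /edge enum_rankK_in // map_len2.
have [||||phi [bphi _]] := recE (generic_complex generic_p) (W := W) (EH := psi @: E) (q := q) (psi := psi).
- by move=> _ /imsetP[e eE ->]; exact: card_psi.
- move=> w; have [e [v [eE ve ->]]] := g_cover w.
  by exists (psi e); rewrite imset_f.
- exact: gq.
- split=> //.
  + by move=> e eE; rewrite imset_f.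
  + move=> e e' eE e'E eqp; apply/eqP; rewrite eqEsubset !psi_sub //.
  + move=> u v uvE x y psixy.
    have neq (T : finType) (a b : T) : #|[set a; b]| = 2 -> a != b.
      by rewrite cards2; case: eqVneq.
    have := lenE _ uvE; rewrite psixy !len2_sqlen; last 2 first.
    * by apply: neq; exact: simpleE.
    * by apply: neq; rewrite -psixy card_psi.
    by move=> /mulfI -> //; rewrite pnatr_eq0.
exact: bij_eq_card bphi.
Qed.

End Reglue.

(** * The two gluings *)

Theorem theorem3p7 (R : realType) (d : nat) (V : finType) (E : {set {set V}}) :
  simple_graph E -> no_isolated E ->
  fully_reconstructible R d E ->
  M_connected R d E.
Proof.
move=> simpleE noisoE recE e f eE fE ef; apply: contrapT => ncirc.
have [p gp] := generic_ex d V R.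
have indP F : rmat_indep R d F <-> lin_indep (rigv p) F.
  by apply: iff_trans (rmat_indep_generic F gp) (rows_indepP p F).
(* An elementary vector through [e] and [f] would have a circuit as its support, against [ncirc]. *)
have [|S [B [eS fS SE indB spanB]]] := @separation _ _ _ (rigv p) E e f eE fE ef.
  move=> u [du u0 minu] su ue; apply/eqP; apply: contraT => uf.
  case: ncirc; exists (supp u); split; rewrite ?inE //; split=> //.
    by move=> /indP/lin_indep_supp/(_ u du (subxx _))/eqP; apply/negP.
  move=> C' C'u; apply/indP/lin_indep_supp => lam dl sl; apply: minu => //.
  exact: sub_proper_trans sl C'u.
have {}indB : rows_indep p B by apply/rows_indepP.
have glue := regluing_card simpleE recE gp indB spanB.
pose Vs (s : bool) := \bigcup_(a in E | (a \in S) == s) a.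
have VsP a v : a \in E -> v \in a -> v \in Vs (a \in S).
  by move=> aE va; apply/bigcupP; exists a => //; rewrite aE eqxx.
have VsE s v : v \in Vs s -> exists a, [/\ a \in E, v \in a & (a \in S) = s].
  by case/bigcupP => a /andP[aE /eqP <-] va; exists a.
have nonempty a : a \in E -> exists v, v \in a.
  by move=> aE; apply/set0Pn; rewrite -card_gt0 simpleE.
have [disj|/set0Pn[v0]] := eqVneq (Vs true :&: Vs false) set0; last first.
  rewrite inE => /andP[v0t v0f].
  (* First gluing: every vertex on both sides is doubled. *)
  pose W := {x : V * bool | x.1 \in Vs x.2}.
  pose w0 : W := Sub (v0, true) v0t.
  pose g s v : W := insubd w0 (v, s).
  have gE a v : a \in E -> v \in a -> val (g (a \in S) v) = (v, a \in S).
    by move=> aE va; rewrite insubdK //; exact: VsP va.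
  have cardVW : #|V| = #|{: W}|.
    apply: (glue W g) => [a b x y aE bE ab xa yb|a b x x' y y' aE bE aS bS xa _ yb _ eqg _|w|y1 y2].
    - by move/(congr1 val); rewrite gE // ab gE // => -[].
    - have := congr1 val eqg; have := gE a x aE xa; have := gE b y bE yb.
      by rewrite aS (negPf bS) => -> ->.
    - have [a [aE va aS]] := VsE _ _ (valP w); exists a, (val w).1; split=> //.
      by apply: val_inj; rewrite gE // aS -surjective_pairing.
    - exists (fun w => (if (val w).2 then y2 else y1) (val w).1) => a aE.
      by apply: eq_len2 => v k va; rewrite gE.
  pose h (w : W) := (val w).1.
  have hsurj : codom h =i predT.
    move=> v; rewrite [RHS]inE; apply/codomP; have [a aE va] := noisoE v.
    by exists (g (a \in S) v); rewrite /h gE.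
  (* The projection to [V] is onto, hence injective by the count, but it merges the two copies of
     [v0]. *)
  have /image_injP hinj : #|codom h| == #|{: W}| by rewrite (eq_card hsurj) -cardVW.
  have : (w0 : W) = Sub (v0, false) v0f by apply: hinj.
  by move/(congr1 val).
have disjV v : v \in Vs true -> v \in Vs false -> False.
  by move=> vt vf; have := in_set0 v; rewrite -disj inE vt vf.
have [v2 v2e] := nonempty e eE; have [v1 v1f] := nonempty f fE.
have v2t : v2 \in Vs true by rewrite -eS; exact: VsP v2e.
have {}v1f : v1 \in Vs false by rewrite -(negPf fS); exact: VsP v1f.
have v12 : v1 != v2 by apply: contraPneq v1f => ->; exact: disjV.
(* Second gluing: [v2], on the side of [S], is identified with [v1] on the other side. *)
pose W := {x : V | x != v2}.
pose w0 : W := Sub v1 v12.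
pose g (s : bool) v : W := insubd w0 (if v == v2 then v1 else v).
have gE s v : val (g s v) = if v == v2 then v1 else v.
  by rewrite insubdK //; case: (eqVneq v v2).
have gF v : v \in Vs false -> val (g false v) = v.
  by move=> vf; rewrite gE; case: eqVneq vf => // -> /(disjV _ v2t).
have gT v : v \in Vs true -> val (g true v) \in Vs false -> val (g true v) = v1.
  by rewrite gE; case: eqVneq => // _ vt /(disjV _ vt).
have cardVW : #|V| = #|{: W}|.
  apply: (glue W g) => [a b x y aE bE ab xa yb|a b x x' y y' aE bE aS bS xa x'a yb y'b|w|y1 y2].
  - have := VsP a x aE xa; have := VsP b y bE yb; rewrite -ab; case: (a \in S) => yV xV.
      move/(congr1 val); rewrite !gE; case: (eqVneq x v2) => [->|_]; case: (eqVneq y v2) => [-> //|_] // e1.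
        by case: (disjV y yV); rewrite -e1.
      by case: (disjV x xV); rewrite e1.
    by move/(congr1 val); rewrite !gF.
  - move=> eqx eqx'; have := VsP b y bE yb; have := VsP b y' bE y'b.
    have := VsP a x aE xa; have := VsP a x' aE x'a; rewrite aS (negPf bS) => x'V xV y'V yV.
    (* An image shared by the two sides can only be [v1]. *)
    have key u z : u \in Vs true -> z \in Vs false -> g true u = g false z -> z = v1.
      by move=> uV zV eqg; have ez : val (g true u) = z by [rewrite eqg gF]; rewrite -ez gT // ez.
    by rewrite (key x y) // (key x' y').
  - have [a aE va] := noisoE (val w); exists a, (val w); split=> //.
    by apply: val_inj; rewrite gE (negPf (valP w)).
  (* The side of [S] is translated so that [v2] lands on the position of [v1]; lengths do not
     change. *)
  - exists (fun w k => if val w \in Vs false then y1 (val w) k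
                       else y2 (val w) k + (y1 v1 k - y2 v2 k)) => a aE.
    have := fun v => VsP a v aE; case: (a \in S) => aV.
      rewrite -(len2_translate y2 (fun k => y1 v1 k - y2 v2 k)).
      apply: eq_len2 => v k /aV vt; rewrite gE.
      have [->|vv2] := eqVneq v v2; first by rewrite v1f; ring.
      by case: ifP => // /(disjV _ vt).
    by apply: eq_len2 => v k /aV vf; rewrite gF // vf.
(* By the count the inclusion of [W] into [V] would be onto, but it misses [v2]. *)
have [h _ hK] : bijective (val : W -> V).
  by apply: inj_card_bij; [exact: val_inj | rewrite cardVW].
by have := valP (h v2); rewrite hK eqxx.
Qed.
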